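(* Let $K$ be a $^*$-continuous KAT with top, $A$ a top Kleene abstract domain of $K$ with maps $\alpha,\gamma$, and $T_{\Sigma,B}$ a KAT language interpreted on $K$ through a pair-valued evaluation. Every triple derivable in the proof system $\mathrm{LCTIL}_A$ is valid.
   Context: Idempotent semiring: $(K,+,0)$ commutative monoid with $a+a=a$, $(K,\cdot,1)$ monoid, two-sided distributivity, $0a=a0=0$; $a\le b$ iff $a+b=b$. KAT: idempotent semiring with Boolean subalgebra $\mathrm{Test}(K)$ (join $+$, meet $\cdot$, complement, bottom $0$, top $1$) and ${}^*$ with $1+aa^*\le a^*$, $1+a^*a\le a^*$, $b+ac\le c\Rightarrow a^*b\le c$, $b+ca\le c\Rightarrow ba^*\le c$. TopKAT: KAT with greatest element $\top$; $^*$-continuous: $\bigvee_nab^nc$ exists and equals $ab^*c$ for all $a,b,c$. $\mathrm{TOP}(K)=\{\top a\mid a\in K\}$. Language: disjoint $\Sigma,B$ ($\mathtt0,\mathtt1\in B$), $\mathrm{Atom}=\Sigma\cup B$, terms $t::=\mathtt a\mid\mathtt0\mid\mathtt1\mid t_1+t_2\mid t_1\cdot t_2\mid t^*$. Evaluation $u:\mathrm{Atom}\to K\times K$ induces $\llbracket t\rrbracket=(\llbracket t\rrbracket_{ok},\llbracket t\rrbracket_{err})$: $\llbracket\mathtt a\rrbracket=u(\mathtt a)$; $\llbracket t_1+t_2\rrbracket$ componentwise sum; $\llbracket t_1\cdot t_2\rrbracket=(\llbracket t_1\rrbracket_{ok}\llbracket t_2\rrbracket_{ok},\llbracket t_1\rrbracket_{err}+\llbracket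 t_1\rrbracket_{ok}\llbracket t_2\rrbracket_{err})$; $\llbracket t^*\rrbracket=(\llbracket t\rrbracket_{ok}^*,\llbracket t\rrbracket_{ok}^*\llbracket t\rrbracket_{err})$. Top Kleene abstract domain: poset $A$, Galois insertion $\alpha:\mathrm{TOP}(K)\to A$, $\gamma:A\to\mathrm{TOP}(K)$ ($\alpha(x)\le_Ay\iff x\le\gamma(y)$, $\alpha\gamma=\mathrm{id}$), countably complete. Abstract semantics ($\varepsilon\in\{ok,err\}$): $\mathcal S^\sharp_\varepsilon[\mathtt c]x=\alpha(\gamma(x)\llbracket\mathtt c\rrbracket_\varepsilon)$; $\mathcal S^\sharp_\varepsilon[t_1+t_2]x=\mathcal S^\sharp_\varepsilon[t_1]x\vee_A\mathcal S^\sharp_\varepsilon[t_2]x$; $\mathcal S^\sharp_{ok}[t_1\cdot t_2]x=\mathcal S^\sharp_{ok}[t_2](\mathcal S^\sharp_{ok}[t_1]x)$; $\mathcal S^\sharp_{err}[t_1\cdot t_2]x=\mathcal S^\sharp_{err}[t_1]x\vee_A\mathcal S^\sharp_{err}[t_2](\mathcal S^\sharp_{ok}[t_1]x)$; $\mathcal S^\sharp_{ok}[t^*]x=\bigvee_n(\mathcal S^\sharp_{ok}[t])^nx$; $\mathcal S^\sharp_{err}[t^*]x=\mathcal S^\sharp_{err}[t](\bigvee_n(\mathcal S^\sharp_{ok}[t])^nx)$. $A(x):=\gamma\alpha(x)$; $\mathbb C^A_b(c)$ iff $A(\top bc)=A(A(\top b)c)$. Triples $[a]t[\varepsilon:b]$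 with $a,b\in K$; valid iff $\top b\le\top a\llbracket t\rrbracket_\varepsilon$ and $\mathcal S^\sharp_\varepsilon[t]\alpha(\top a)=\alpha(\top b)=\alpha(\top a\llbracket t\rrbracket_\varepsilon)$. $[a]t[ok:b][err:c]$ stands for both $[a]t[ok:b]$ and $[a]t[err:c]$. $\mathrm{LCTIL}_A$ rules ($\varepsilon$-rules are schemes for each $\varepsilon$): (transfer) $\mathtt c\in\mathrm{Atom}$, $\mathbb C^A_a(\llbracket\mathtt c\rrbracket_{ok})$, $\mathbb C^A_a(\llbracket\mathtt c\rrbracket_{err})$ $\vdash[a]\mathtt c[ok:a\llbracket\mathtt c\rrbracket_{ok}][err:a\llbracket\mathtt c\rrbracket_{err}]$; (relax) $\top a'\le\top a\le A(\top a')$, $[a']t[\varepsilon:b']$, $\top b\le\top b'\le A(\top b)$ $\vdash[a]t[\varepsilon:b]$; (seq-ok) $[a]t_1[ok:r]$, $[r]t_2[ok:b]$ $\vdash[a]t_1\cdot t_2[ok:b]$; (seq-err) $[a]t_1[ok:b][err:r]$, $[b]t_2[err:s]$ $\vdash[a]t_1\cdot t_2[err:r+s]$; (rec-err) $[a]t^*[ok:b]$, $[b]t[err:r]$ $\vdash[a]t^*[err:r]$; (join) $[a]t_1[\varepsilon:b_1]$, $[a]t_2[\varepsilon:b_2]$ $\vdash[a]t_1+t_2[\varepsilon:b_1+b_2]$; (limit) $[a_n]t[ok:a_{n+1}]$ for all $n$ $\vdash[a_0]t^*[ok:\bigvee_na_n]$, applicable only when $\bigvee_na_n$ exists and $\top\bigvee_na_n=\bigvee_n\top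 a_n$. *)

(* Defs.v *)
From HB Require Import structures.
From mathcomp Require Import all_boot all_order all_algebra.
From mathcomp Require Import boolp classical_sets functions cardinality.

Set Implicit Arguments.
Unset Strict Implicit.
Unset Printing Implicit Defensive.

Import Order.TTheory GRing.Theory.

Local Open Scope classical_set_scope.
Local Open Scope ring_scope.

HB.mixin Record isIdemSemiRing K of GRing.PzSemiRing K := {
  idem_addxx : forall a : K, a + a = a
}.

#[short(type="idemSemiRingType")]
HB.structure Definition IdemSemiRing :=
  { K of isIdemSemiRing K & GRing.PzSemiRing K }.

Definition kle (K : idemSemiRingType) (a b : K) : Prop := a + b = b.

Notation "a <=k b" := (kle a b) (at level 70, no associativity) : ring_scope.

(* [test_compl] is only specified on tests.  Associativity, commutativity and
   idempotence of the join +, as well as distributivity of the meet over the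
   join, are inherited from the ambient semiring. *)
HB.mixin Record isKAT K of IdemSemiRing K := {
  test : set K ;
  test_compl : K -> K ;
  star : K -> K ;
  test0 : test 0 ;
  test1 : test 1 ;
  testD : forall p q, test p -> test q -> test (p + q) ;
  testM : forall p q, test p -> test q -> test (p * q) ;
  test_complP : forall p, test p -> test (test_compl p) ;
  test_mulC : forall p q, test p -> test q -> p * q = q * p ;
  test_mulxx : forall p, test p -> p * p = p ;
  test_mulDK : forall p q, test p -> test q -> p * (p + q) = p ;
  test_addMK : forall p q, test p -> test q -> p + p * q = p ;
  test_addMr : forall p q r, test p -> test q -> test r ->
    p + q * r = (p + q) * (p + r) ;
  test_addC : forall p, test p -> p + test_compl p = 1 ;
  test_mulCr : forall p, test p -> p * test_compl p = 0 ;
  star_unfoldl : forall a : K, 1 + a * star a <=k star a ;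
  star_unfoldr : forall a : K, 1 + star a * a <=k star a ;
  star_indl : forall a b c : K, b + a * c <=k c -> star a * b <=k c ;
  star_indr : forall a b c : K, b + c * a <=k c -> b * star a <=k c
}.

#[short(type="katType")]
HB.structure Definition KAT := { K of isKAT K & IdemSemiRing K }.

HB.mixin Record hasKTop K of KAT K := {
  ktop : K ;
  ktop_max : forall a : K, a <=k ktop
}.

#[short(type="topKatType")]
HB.structure Definition TopKAT := { K of hasKTop K & KAT K }.

Definition is_join (K : idemSemiRingType) (f : nat -> K) (x : K) : Prop :=
  (forall n, f n <=k x) /\ (forall y, (forall n, f n <=k y) -> x <=k y).

Definition star_continuous (K : katType) : Prop :=
  forall a b c : K, is_join (fun n : nat => a * b ^+ n * c) (a * star b * c).

Definition TOP (K : topKatType) : set K := range (fun a : K => ktop * a).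
Arguments TOP : clear implicits.

Lemma TOP_top_mul (K : topKatType) (a : K) : ktop * a \in TOP K.
Proof. by apply/mem_set; exists a. Qed.

Lemma TOP_mulr (K : topKatType) (x : TOP K) (c : K) : \val x * c \in TOP K.
Proof.
case: x => x /= /set_mem [a _ <-]; apply/mem_set; exists (a * c) => //.
by rewrite mulrA.
Qed.

Definition topM (K : topKatType) (a : K) : TOP K :=
  exist _ (ktop * a) (TOP_top_mul a).

Definition TOPmul (K : topKatType) (x : TOP K) (c : K) : TOP K :=
  exist _ (\val x * c) (TOP_mulr x c).

(* Disjointness of the alphabets is rendered by the sum type [atom]. *)
Record katLanguage := KatLanguage {
  action_sym : Type ;
  test_sym : Type ;
  sym0 : test_sym ;
  sym1 : test_sym ;
  sym0_neq1 : sym0 <> sym1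
}.

Definition atom (L : katLanguage) : Type := (action_sym L + test_sym L)%type.

(* The constants 0 and 1 belong to the test alphabet, hence are atoms: the
   corresponding productions are [term0] and [term1]. *)
Inductive term (L : katLanguage) : Type :=
| TAtom of atom L
| TAdd of term L & term L
| TMul of term L & term L
| TStar of term L.

Definition term0 (L : katLanguage) : term L := TAtom (inr (sym0 L)).
Definition term1 (L : katLanguage) : term L := TAtom (inr (sym1 L)).

Inductive outcome := ok | err.

Definition component (T : Type) (e : outcome) (p : T * T) : T :=
  match e with ok => p.1 | err => p.2 end.

Fixpoint eval_pair (K : katType) (L : katLanguage) (u : atom L -> K * K)
    (t : term L) : K * K :=
  match t with
  | TAtom c => u c
  | TAdd t1 t2 =>
      ((eval_pair u t1).1 + (eval_pair u t2).1,
       (eval_pair u t1).2 + (eval_pair u t2).2)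
  | TMul t1 t2 =>
      ((eval_pair u t1).1 * (eval_pair u t2).1,
       (eval_pair u t1).2 + (eval_pair u t1).1 * (eval_pair u t2).2)
  | TStar t1 =>
      (star (eval_pair u t1).1, star (eval_pair u t1).1 * (eval_pair u t1).2)
  end.

Definition eval (K : katType) (L : katLanguage) (u : atom L -> K * K)
    (e : outcome) (t : term L) : K := component e (eval_pair u t).

Record top_kleene_domain (K : topKatType) (d : Order.disp_t)
    (A : porderType d) (alpha : TOP K -> A) (gamma : A -> TOP K) : Prop := {
  tkd_adjoint : forall (x : TOP K) (y : A),
    (alpha x <= y)%O <-> \val x <=k \val (gamma y) ;
  tkd_insertion : cancel gamma alpha ;
  tkd_countably_complete : forall S : set A,
    countable S -> supremums S !=set0
}.

(* Binary and countable joins; [supremum x0 S] is the least upper bound of S,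
   the default x0 being irrelevant whenever S is nonempty and has one. *)
Definition ajoin (d : Order.disp_t) (A : porderType d) (x y : A) : A :=
  supremum x [set x; y].

Definition acjoin (d : Order.disp_t) (A : porderType d) (f : nat -> A) : A :=
  supremum (f 0%N) (range f).

Fixpoint abs_sem (K : topKatType) (d : Order.disp_t) (A : porderType d)
    (alpha : TOP K -> A) (gamma : A -> TOP K) (L : katLanguage)
    (u : atom L -> K * K) (t : term L) (e : outcome) (x : A) {struct t} : A :=
  let S := abs_sem alpha gamma u in
  match t, e with
  | TAtom c, _ => alpha (TOPmul (gamma x) (eval u e (TAtom c)))
  | TAdd t1 t2, _ => ajoin (S t1 e x) (S t2 e x)
  | TMul t1 t2, ok => S t2 ok (S t1 ok x)
  | TMul t1 t2, err => ajoin (S t1 err x) (S t2 err (S t1 ok x))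
  | TStar t1, ok => acjoin (fun n => iter n (S t1 ok) x)
  | TStar t1, err => S t1 err (acjoin (fun n => iter n (S t1 ok) x))
  end.

Definition abs_closure (K : topKatType) (d : Order.disp_t) (A : porderType d)
    (alpha : TOP K -> A) (gamma : A -> TOP K) (x : TOP K) : TOP K :=
  gamma (alpha x).

Definition locally_complete (K : topKatType) (d : Order.disp_t)
    (A : porderType d) (alpha : TOP K -> A) (gamma : A -> TOP K)
    (b c : K) : Prop :=
  abs_closure alpha gamma (topM (b * c)) =
  abs_closure alpha gamma (TOPmul (abs_closure alpha gamma (topM b)) c).

(* The triple [a] t [e : b]. *)
Definition valid (K : topKatType) (d : Order.disp_t) (A : porderType d)
    (alpha : TOP K -> A) (gamma : A -> TOP K) (L : katLanguage)
    (u : atom L -> K * K) (a : K) (t : term L) (e : outcome) (b : K) : Prop :=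
  [/\ ktop * b <=k ktop * a * eval u e t,
      abs_sem alpha gamma u t e (alpha (topM a)) = alpha (topM b)
    & alpha (topM b) = alpha (TOPmul (topM a) (eval u e t))].

(* Derivability of the triple [a] t [e : b].  A premise or conclusion
   [a] t [ok : b] [err : c] is split into its two triples. *)
Inductive lctil (K : topKatType) (d : Order.disp_t) (A : porderType d)
    (alpha : TOP K -> A) (gamma : A -> TOP K) (L : katLanguage)
    (u : atom L -> K * K) : K -> term L -> outcome -> K -> Prop :=
| lctil_transfer (a : K) (c : atom L) (e : outcome) :
    locally_complete alpha gamma a (eval u ok (TAtom c)) ->
    locally_complete alpha gamma a (eval u err (TAtom c)) ->
    lctil alpha gamma u a (TAtom c) e (a * eval u e (TAtom c))
| lctil_relax (a a' b b' : K) (t : term L) (e : outcome) :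
    ktop * a' <=k ktop * a ->
    ktop * a <=k \val (abs_closure alpha gamma (topM a')) ->
    lctil alpha gamma u a' t e b' ->
    ktop * b <=k ktop * b' ->
    ktop * b' <=k \val (abs_closure alpha gamma (topM b)) ->
    lctil alpha gamma u a t e b
| lctil_seq_ok (a r b : K) (t1 t2 : term L) :
    lctil alpha gamma u a t1 ok r ->
    lctil alpha gamma u r t2 ok b ->
    lctil alpha gamma u a (TMul t1 t2) ok b
| lctil_seq_err (a b r s : K) (t1 t2 : term L) :
    lctil alpha gamma u a t1 ok b ->
    lctil alpha gamma u a t1 err r ->
    lctil alpha gamma u b t2 err s ->
    lctil alpha gamma u a (TMul t1 t2) err (r + s)
| lctil_rec_err (a b r : K) (t : term L) :
    lctil alpha gamma u a (TStar t) ok b ->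
    lctil alpha gamma u b t err r ->
    lctil alpha gamma u a (TStar t) err r
| lctil_join (a b1 b2 : K) (t1 t2 : term L) (e : outcome) :
    lctil alpha gamma u a t1 e b1 ->
    lctil alpha gamma u a t2 e b2 ->
    lctil alpha gamma u a (TAdd t1 t2) e (b1 + b2)
| lctil_limit (a : nat -> K) (s : K) (t : term L) :
    (forall n, lctil alpha gamma u (a n) t ok (a n.+1)) ->
    is_join a s ->
    is_join (fun n => ktop * a n) (ktop * s) ->
    lctil alpha gamma u (a 0%N) (TStar t) ok s.

(* Main.v *)
Require Import Defs.
From mathcomp Require Import all_boot all_order all_algebra.
From mathcomp Require Import boolp classical_sets.
From mathcomp Require Import cardinality.

(** Write [S] for the abstract semantics. It is sound,
    [gamma y * [[t]] <= gamma (S t y)] for every [y]; the star case is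
    *-continuity, and monotonicity of [S] is never needed. Consequently the
    third clause of validity follows from the first two:
    [alpha (top b) <= alpha (top a [[t]]) <= S t (alpha (top a)) = alpha (top b)].
    The first two clauses are then propagated through each rule, using that
    [alpha], as a lower adjoint, preserves the joins existing in [K]. *)

Set Implicit Arguments.
Unset Strict Implicit.
Unset Printing Implicit Defensive.

Import Order.TTheory GRing.Theory.

Local Open Scope classical_set_scope.
Local Open Scope ring_scope.

Section IdemSemiRingOrder.
Variable K : idemSemiRingType.
Implicit Types a b c x y : K.

Lemma kle_refl a : a <=k a.
Proof. exact: idem_addxx. Qed.

Lemma kle_trans b a c : a <=k b -> b <=k c -> a <=k c.
Proof. by rewrite /kle => ab bc; rewrite -bc addrA ab. Qed.

Lemma kle_addl a b : a <=k a + b.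
Proof. by rewrite /kle addrA idem_addxx. Qed.

Lemma kle_addr a b : b <=k a + b.
Proof. by rewrite addrC; exact: kle_addl. Qed.

Lemma kle_add_lub a b c : a <=k c -> b <=k c -> a + b <=k c.
Proof. by rewrite /kle => ac bc; rewrite -addrA bc. Qed.

Lemma kle_add a b x y : a <=k x -> b <=k y -> a + b <=k x + y.
Proof.
move=> ax bY; apply: kle_add_lub.
  exact: kle_trans ax (kle_addl _ _).
exact: kle_trans bY (kle_addr _ _).
Qed.

Lemma kle_mulr c a b : a <=k b -> a * c <=k b * c.
Proof. by rewrite /kle => ab; rewrite -mulrDl ab. Qed.

End IdemSemiRingOrder.

(** [supremum] selects an arbitrary element of [supremums S]; antisymmetry leaves only one
    candidate. *)
Lemma supremum_eq (d : Order.disp_t) (A : porderType d) (S : set A) (x0 x : A) :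
  S !=set0 -> supremums S x -> supremum x0 S = x.
Proof.
move=> /set0P /negPf S0 Sx; rewrite /supremum S0.
case: xgetP => [y _ Sy | /(_ x) //].
exact: is_subset1_supremums Sy Sx.
Qed.

Section StarContinuous.
Variable (K : katType) (Kcont : star_continuous K).

Lemma mul_exp_le_star (a b : K) n : a * b ^+ n <=k a * star b.
Proof. by have := (Kcont a b 1).1 n; rewrite !mulr1. Qed.

Lemma mul_star_lub (a b y : K) :
  (forall n, a * b ^+ n <=k y) -> a * star b <=k y.
Proof.
move=> le_y; rewrite -[a * _]mulr1; apply: (Kcont a b 1).2 => n.
by rewrite mulr1.
Qed.

End StarContinuous.

Section TopKleeneDomain.
Variables (K : topKatType) (d : Order.disp_t) (A : porderType d).
Variables (alpha : TOP K -> A) (gamma : A -> TOP K).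
Hypothesis hA : top_kleene_domain alpha gamma.
Implicit Types (x y : TOP K) (p q : A).

Lemma alpha_le_gamma x p : \val x <=k \val (gamma p) -> (alpha x <= p)%O.
Proof. by move/(tkd_adjoint hA). Qed.

Lemma gamma_alpha_ge x : \val x <=k \val (gamma (alpha x)).
Proof. exact/(tkd_adjoint hA). Qed.

Lemma gamma_mono p q : (p <= q)%O -> \val (gamma p) <=k \val (gamma q).
Proof. by move=> pq; apply/(tkd_adjoint hA); rewrite (tkd_insertion hA). Qed.

Lemma alpha_mono x y : \val x <=k \val y -> (alpha x <= alpha y)%O.
Proof. by move=> xy; apply/alpha_le_gamma/(kle_trans xy)/gamma_alpha_ge. Qed.

(** An element squeezed between [x] and its closure has the same abstraction as [x]; both side
    conditions of the relax rule have this shape. *)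
Lemma alpha_closure_eq x y :
  \val x <=k \val y -> \val y <=k \val (abs_closure alpha gamma x) ->
  alpha x = alpha y.
Proof.
move=> xy yx; apply/le_anti/andP; split; first exact: alpha_mono.
exact: alpha_le_gamma.
Qed.

(** Countable completeness guarantees that a supremum exists, so [supremum] does not fall back on
    [p0]. *)
Lemma supremum_ub (S : set A) (p0 p : A) :
  countable S -> S p -> (p <= supremum p0 S)%O.
Proof.
move=> /(tkd_countably_complete hA) [s Ss] Sp.
by rewrite (supremum_eq _ _ Ss); [exact: Ss.1 | exists p].
Qed.

Lemma countable_pair p q : countable [set p; q].
Proof. exact/finite_set_countable/finite_set2. Qed.

Lemma ajoin_ubl p q : (p <= ajoin p q)%O.
Proof. by apply: supremum_ub (countable_pair p q) _; left. Qed.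

Lemma ajoin_ubr p q : (q <= ajoin p q)%O.
Proof. by apply: supremum_ub (countable_pair p q) _; right. Qed.

Lemma acjoin_ub (f : nat -> A) n : (f n <= acjoin f)%O.
Proof.
apply: supremum_ub; last by exists n.
exact/(sub_countable (card_image_le f setT))/countableP.
Qed.

(** A lower adjoint preserves joins: by adjunction, an upper bound [p] of both abstractions gives
    [gamma p] above [top a] and [top b], hence above their sum. *)
Lemma ajoin_alpha (a b : K) :
  ajoin (alpha (topM a)) (alpha (topM b)) = alpha (topM (a + b)).
Proof.
apply: supremum_eq; first by exists (alpha (topM a)); left.
split=> [p /= [->|->]|p ub_p].
- by apply: alpha_mono; rewrite /= mulrDr; exact: kle_addl.
- by apply: alpha_mono; rewrite /= mulrDr; exact: kle_addr.
apply: alpha_le_gamma; rewrite /= mulrDr.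
by apply: kle_add_lub; apply/(tkd_adjoint hA (topM _)); apply: ub_p;
  [left | right].
Qed.

(** The countable analogue; the join is that of the [top a_n], as in the side condition of the limit
    rule. *)
Lemma acjoin_alpha (a : nat -> K) (s : K) :
  is_join (fun n => ktop * a n) (ktop * s) ->
  acjoin (fun n => alpha (topM (a n))) = alpha (topM s).
Proof.
move=> [s_ub s_lub]; apply: supremum_eq.
  by exists (alpha (topM (a 0%N))), 0%N.
split=> [p /= [n _ <-]|p ub_p]; first by apply: alpha_mono; exact: s_ub.
apply: alpha_le_gamma; apply: s_lub => n.
by apply/(tkd_adjoint hA (topM _)); apply: ub_p; exists n.
Qed.

Section Semantics.
Hypothesis Kcont : star_continuous K.
Variables (L : katLanguage) (u : atom L -> K * K).

Lemma abs_sem_sound (t : term L) (e : outcome) p :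
  \val (gamma p) * eval u e t <=k \val (gamma (abs_sem alpha gamma u t e p)).
Proof.
(* Isolated because both outcomes of a star use it. The assumption ranges over all [r], since it is
   applied at every iterate. *)
have star_ok t1 q :
    (forall r, \val (gamma r) * eval u ok t1
                 <=k \val (gamma (abs_sem alpha gamma u t1 ok r))) ->
    \val (gamma q) * star (eval u ok t1) <=k
      \val (gamma (acjoin (fun n => iter n (abs_sem alpha gamma u t1 ok) q))).
  move=> IH; apply: mul_star_lub => // n.
  apply: (@kle_trans _ (\val (gamma (iter n (abs_sem alpha gamma u t1 ok) q)))).
    elim: n => [|n IHn]; first by rewrite expr0 mulr1; exact: kle_refl.
    (* The power is peeled on the right because [iter] adds its new application last. *)
    by rewrite exprSr mulrA; apply: kle_trans (kle_mulr _ IHn) (IH _).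
  apply: gamma_mono.
  exact: (acjoin_ub (fun n => iter n (abs_sem alpha gamma u t1 ok) q)).
elim: t e p => [c|t1 IH1 t2 IH2|t1 IH1 t2 IH2|t1 IH1] e p.
- exact: (gamma_alpha_ge (TOPmul _ _)).
- have -> : eval u e (TAdd t1 t2) = eval u e t1 + eval u e t2 by case: e.
  rewrite mulrDr; apply: kle_add_lub.
    by apply: kle_trans (IH1 _ _) (gamma_mono _); case: e; exact: ajoin_ubl.
  by apply: kle_trans (IH2 _ _) (gamma_mono _); case: e; exact: ajoin_ubr.
- case: e.
    rewrite [eval _ _ _]/= mulrA.
    exact: kle_trans (kle_mulr _ (IH1 ok _)) (IH2 ok _).
  rewrite [eval _ _ _]/= mulrDr mulrA; apply: kle_add_lub.
    exact: kle_trans (IH1 err _) (gamma_mono (ajoin_ubl _ _)).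
  apply: kle_trans (kle_mulr _ (IH1 ok _)) _.
  exact: kle_trans (IH2 err _) (gamma_mono (ajoin_ubr _ _)).
- case: e; first exact: star_ok.
  rewrite [eval _ _ _]/= mulrA.
  apply: kle_trans (kle_mulr _ (star_ok _ _ (IH1 ok))) _.
  exact: (IH1 err).
Qed.

Lemma valid_intro a (t : term L) e b :
  ktop * b <=k ktop * a * eval u e t ->
  abs_sem alpha gamma u t e (alpha (topM a)) = alpha (topM b) ->
  valid alpha gamma u a t e b.
Proof.
move=> b_le Sb; split=> //; apply/le_anti/andP; split; first exact: alpha_mono.
rewrite -Sb; apply: alpha_le_gamma.
exact: kle_trans (kle_mulr _ (gamma_alpha_ge (topM a))) (abs_sem_sound _ _ _).
Qed.

End Semantics.
End TopKleeneDomain.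

Theorem theorem12 (K : topKatType) (Kcont : star_continuous K)
    (d : Order.disp_t) (A : porderType d)
    (alpha : TOP K -> A) (gamma : A -> TOP K)
    (hA : top_kleene_domain alpha gamma)
    (L : katLanguage) (u : atom L -> K * K)
    (a : K) (t : term L) (e : outcome) (b : K) :
  lctil alpha gamma u a t e b -> valid alpha gamma u a t e b.
Proof.
elim=> {a t e b}.
- move=> a c e lc_ok lc_err; apply: (valid_intro hA Kcont).
    by rewrite mulrA; exact: kle_refl.
  have lc : locally_complete alpha gamma a (eval u e (TAtom c)) by case: e.
  (* Applying [alpha] cancels the outer closures and leaves [alpha (top a c) = alpha (gamma (alpha
     (top a)) c)], whose right side is the abstract semantics of the atom. *)
  have := congr1 alpha lc; rewrite /abs_closure !(tkd_insertion hA) => ->.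
  by case: e {lc}.
- move=> a a' b b' t e a'a aa' _ [le_b' Sb' _] bb' b'b.
  apply: (valid_intro hA Kcont).
    exact: kle_trans bb' (kle_trans le_b' (kle_mulr _ a'a)).
  rewrite -(alpha_closure_eq hA (x := topM a') (y := topM a) a'a aa') Sb'.
  exact/esym/(alpha_closure_eq hA (x := topM b) (y := topM b') bb' b'b).
- move=> a r b t1 t2 _ [le_r Sr _] _ [le_b Sb _]; apply: (valid_intro hA Kcont).
    by rewrite [eval _ _ _]/= mulrA; exact: kle_trans le_b (kle_mulr _ le_r).
  by rewrite /= Sr.
- move=> a b r s t1 t2 _ [le_b Sb _] _ [le_r Sr _] _ [le_s Ss _].
  apply: (valid_intro hA Kcont).
    rewrite [eval _ _ _]/= !mulrDr [X in _ <=k _ + X]mulrA; apply: kle_add => //.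
    exact: kle_trans le_s (kle_mulr _ le_b).
  by rewrite /= Sb Sr Ss (ajoin_alpha hA).
- move=> a b r t _ [le_b Sb _] _ [le_r Sr _]; apply: (valid_intro hA Kcont).
    by rewrite [eval _ _ _]/= mulrA; exact: kle_trans le_r (kle_mulr _ le_b).
  (* By definition, the abstract error of a star is that of its body after the abstract [ok]
     iteration, which [Sb] identifies with [alpha (top b)]. *)
  by rewrite -Sr -Sb.
- move=> a b1 b2 t1 t2 e _ [le1 S1 _] _ [le2 S2 _]; apply: (valid_intro hA Kcont).
    have -> : eval u e (TAdd t1 t2) = eval u e t1 + eval u e t2.
      by case: e {S1 S2 le1 le2}.
    by rewrite !mulrDr; exact: kle_add.
  rewrite -(ajoin_alpha hA) -S1 -S2.
  by case: e {S1 S2 le1 le2}.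
- move=> a s t _ IH _ s_join; apply: (valid_intro hA Kcont).
    (* Since [top s] is the join of the [top a_n], it suffices that [top a_n] lies below [top a_0]
       times the [n]-th power of the body. *)
    apply: s_join.2 => n; apply: kle_trans (mul_exp_le_star Kcont _ _ n).
    elim: n => [|n IHn]; first by rewrite expr0 mulr1; exact: kle_refl.
    rewrite exprSr mulrA; apply: kle_trans (kle_mulr _ IHn).
    by case: (IH n).
  (* The two joins agree term by term: the [n]-th abstract iterate from [alpha (top a_0)] is exactly
     [alpha (top a_n)]. *)
  rewrite -(acjoin_alpha hA s_join) /=; congr acjoin; apply/funext.
  by elim=> //= n ->; case: (IH n).
Qed.
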